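(* Let $E$ and $E'$ be real Banach spaces of dimension at least two and let $G\subsetneq E$, $G'\subsetneq E'$ be domains. Let $G$ be a length John domain and let $f:G\to G'$ be $(M,C)$-CQH. If $f$ extends to a homeomorphism $\overline f:\overline G\to\overline{G'}$ which is $\eta$-quasisymmetric relative to $\delta G$, then $G'$ is a length John domain.
   Context: A domain is an open connected set. The norm is written $|\cdot|$; $\delta G=\overline G\setminus G$ is the boundary of $G$, and $\delta_G(x)=\inf\{|x-y|:y\in\delta G\}$ for $x\in G$. A curve is a continuous map from a closed interval; it joins its endpoints. For points $u,v$ on a curve $\gamma$, $\gamma[u,v]$ is the part of $\gamma$ from $u$ to $v$, and $l$ denotes length. For $c\ge 1$, a domain $G\subsetneq E$ is length $c$-John (or simply $c$-John) if each pair of points $x_1,x_2\in G$ can be joined by a curve $\gamma$ in $G$ with $\min_{j=1,2} l(\gamma[x_j,x])\le c\,\delta_G(x)$ for all $x\in\gamma$. $G$ is a length John domain if it is length $c$-John for some $c\ge1$. The quasihyperbolic length of a rectifiable arc $\gamma$ in a domain $G\subsetneq E$ is $l_k(\gamma)=\int_\gamma \frac{|dz|}{\delta_G(z)}$, and the quasihyperbolic distance is $k_G(x,y)=\inf_\gamma l_k(\gamma)$ over all rectifiable arcs $\gamma$ in $G$ joining $x$ and $y$. A homeomorphism $f:G\to G'$ is $(M,C)$-CQH ($C$-coarsely $M$-quasihyperbolic) if $$\frac{k_G(x,y)-C}{M}\le k_{G'}(f(x),f(y))\le M k_G(x,y)+C\quad\text{for all }x,y\in G.$$ Quasisymmetry: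 a triple in a metric space $X$ is an ordered sequence $T=(x,y,z)$ of three distinct points, with ratio $\rho(T)=|y-x|/|z-x|$. For $A\subset X$, $T=(x,y,z)$ is a triple in the pair $(X,A)$ if $x\in A$ or $\{y,z\}\subset A$. Given a homeomorphism $\eta:[0,\infty)\to[0,\infty)$, an embedding $f:X\to Y$ of metric spaces is $\eta$-quasisymmetric relative to $A$ if $\rho(f(T))\le\eta(\rho(T))$ for every triple $T$ in $(X,A)$, where $f(T)=(f(x),f(y),f(z))$. Here $X=\overline G$, $A=\delta G$. *)

(* Defs.v *)
From HB Require Import structures.
From mathcomp Require Import all_boot all_order all_algebra.
From mathcomp Require Import all_classical all_reals all_analysis.

Set Implicit Arguments.
Unset Strict Implicit.
Unset Printing Implicit Defensive.

Import Order.TTheory GRing.Theory Num.Theory.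
Import numFieldNormedType.Exports.

Local Open Scope classical_set_scope.
Local Open Scope ring_scope.

Definition dim_ge2 (R : realType) (E : normedModType R) : Prop :=
  exists u v : E, forall a b : R, a *: u + b *: v = 0 -> a = 0 /\ b = 0.

Definition is_domain (T : topologicalType) (G : set T) : Prop :=
  open G /\ connected G.

(* This is the topological frontier only for open [G], the case used here. *)
Definition boundary (T : topologicalType) (G : set T) : set T :=
  closure G `\` G.

(* For a nonempty domain [G <> setT] the boundary is nonempty, so that the
   convention [inf set0 = 0] plays no role. *)
Definition bdist (R : realType) (E : normedModType R) (G : set E) (x : E) : R :=
  inf [set `|x - y| | y in boundary G].

(* Maps between subsets are represented by total functions, of which only the
   restriction to [A] matters; [{within A, continuous f}] is continuity for the
   relative topology of [A]. *)
Definition homeomorphism_on (T U : topologicalType) (A : set T) (B : set U)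
    (f : T -> U) : Prop :=
  exists g : U -> T,
    [/\ (forall x, A x -> B (f x) /\ g (f x) = x),
        (forall y, B y -> A (g y) /\ f (g y) = y),
        {within A, continuous f} & {within B, continuous g}].

Definition embedding_on (T U : topologicalType) (A : set T) (f : T -> U)
    : Prop :=
  homeomorphism_on A (f @` A) f.

Section Curves.
Context {R : realType} {E : normedModType R}.
Implicit Types (G : set E) (g : R -> E) (a b c : R) (x y : E).

(* A curve is given by a map [g] and its parameter interval [a, b]; the
   degenerate case [a = b] is allowed, so constant curves are covered. *)
Definition curve_joining G x y a b g : Prop :=
  [/\ a <= b, {within `[a, b], continuous g},
      (forall t, t \in `[a, b] -> G (g t)), g a = x & g b = y].

Definition curve_length a b g : \bar R :=
  ereal_sup [set (\sum_(0 <= n < size s)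
                    `|g (nth b (a :: s) n.+1) - g (nth b (a :: s) n)|)%:E
            | s in itv_partition a b].

Definition rectifiable a b g : Prop := (curve_length a b g < +oo)%E.

Definition arc_joining G x y a b g : Prop :=
  curve_joining G x y a b g /\
  (forall s t, s \in `[a, b] -> t \in `[a, b] -> g s = g t -> s = t).

(* The parametrization of a rectifiable arc by arc length, on
   [0, curve_length a b g]: the point at parameter [u] is [g t] for the first
   [t] such that the part of the arc from [g a] to [g t] has length at
   least [u]. *)
Definition arclength_param a b g (u : R) : E :=
  g (inf [set t | t \in `[a, b] /\ (u%:E <= curve_length a t g)%E]).

(* The integral of [rho] along a rectifiable arc with respect to |dz|. *)
Definition line_integral (rho : E -> R) a b g : \bar R :=
  (\int[lebesgue_measure]_(u in `[0%R, fine (curve_length a b g)])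
     (rho (arclength_param a b g u))%:E)%E.

Definition qh_length G a b g : \bar R :=
  line_integral (fun z => (bdist G z)^-1) a b g.

Definition qh_dist G x y : \bar R :=
  ereal_inf [set l | exists a b g,
    [/\ arc_joining G x y a b g, rectifiable a b g & l = qh_length G a b g]].

(* The points of the curve are indexed by the parameter: the parts of the curve
   from its endpoints to the point [g t] are the restrictions of [g] to [a, t]
   and [t, b]. *)
Definition length_cJohn c G : Prop :=
  forall x1 x2, G x1 -> G x2 ->
    exists a b g, curve_joining G x1 x2 a b g /\
      forall t, t \in `[a, b] ->
        (Order.min (curve_length a t g) (curve_length t b g)
           <= (c * bdist G (g t))%:E)%E.

Definition length_John G : Prop := exists c, 1 <= c /\ length_cJohn c G.

End Curves.

Definition CQH (R : realType) (E E' : normedModType R) (M C : R)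
    (G : set E) (G' : set E') (f : E -> E') : Prop :=
  homeomorphism_on G G' f /\
  forall x y, G x -> G y ->
    (M^-1%:E * (qh_dist G x y - C%:E) <= qh_dist G' (f x) (f y) /\
     qh_dist G' (f x) (f y) <= M%:E * qh_dist G x y + C%:E)%E.

Definition ratio (R : realType) (E : normedModType R) (x y z : E) : R :=
  `|y - x| / `|z - x|.

(* [f] is an embedding of the subspace [X], quasisymmetric relative to
   [A], where [A `<=` X]. *)
Definition quasisymmetric_rel (R : realType) (E E' : normedModType R)
    (eta : R -> R) (X A : set E) (f : E -> E') : Prop :=
  embedding_on X f /\
  forall x y z, X x -> X y -> X z -> x <> y -> x <> z -> y <> z ->
    A x \/ (A y /\ A z) ->
    ratio (f x) (f y) (f z) <= eta (ratio x y z).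

(* Main.v *)
Require Import Defs.
From HB Require Import structures.
From mathcomp Require Import all_boot all_order all_algebra.
From mathcomp Require Import all_classical all_reals all_analysis.
From mathcomp Require Import measurable_realfun ring lra.

Set Implicit Arguments.
Unset Strict Implicit.
Unset Printing Implicit Defensive.

Import Order.TTheory GRing.Theory Num.Theory.
Import numFieldNormedType.Exports.
Local Open Scope classical_set_scope.
Local Open Scope ring_scope.

(** The John condition asks for curves that, seen from each end, run away from
    the boundary like a cone.  Such a curve splits at a point [y] into two
    carrots [x1 -> y] and [x2 -> y]: paths on which the length covered from the
    tip is at most a multiple of the distance to the boundary
    ([John_carrots], and [carrots_John] for the converse).  Hence it suffices to
    map carrots to carrots ([carrot_image]).

    The image of a carrot need not be rectifiable, so it is rebuilt.  Points of
    the carrot within half their distance to the boundary are at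
    quasihyperbolic distance at most one ([qh_dist_le1]), so their images are at
    bounded quasihyperbolic distance by the coarse upper bound.  An almost
    minimizing arc between the images is then a path of length comparable to the
    distance to the boundary, along which that distance stays comparable
    ([linked_of_qh_dist]); this is the usual logarithmic estimate
    [qh_length_distortion].  Boundedly many such links again form a link
    ([linked_chain]), and this connects the images of any two points of the
    carrot between which the distance to the boundary changes by a bounded
    factor.

    What keeps the total length under control is relative quasisymmetry.
    Where the distance to the boundary has grown by a large factor along the
    carrot, the distance of the image to the boundary has at least doubled
    ([image_bdist_decay]).  The lengths of the successive links are therefore
    dominated by a geometric series, and the part of the new path up to any of
    its points is comparable to the last link reached, hence to the distance to
    the boundary there. *)

(** * Distance to the boundary *)

Section BoundaryDistance.
Context {R : realType} {E : normedModType R}.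
Implicit Types (G : set E) (x y z : E).

(** Walking from inside [G] to outside along a segment, one crosses the
    boundary: otherwise [G] would cut out a clopen part of the segment. *)
Lemma segment_meets_boundary G x w : open G -> G x -> ~ G w ->
  exists2 z, boundary G z & `|x - z| <= `|x - w|.
Proof.
move=> oG Gx Gw.
pose p (t : R) : E := x + t *: (w - x).
have cp : continuous p.
  move=> t; apply: cvgD; first exact: cvg_cst.
  by apply: cvgZ; [exact: cvg_id|exact: cvg_cst].
have [[t /= t01 [cGt Gt]]|noz] := pselect (exists2 t : R, t \in `[0, 1] & boundary G (p t)).
  exists (p t) => //; rewrite /p opprD addNKr normrN normrZ distrC.
  by move: t01; rewrite in_itv/= => /andP[t0 t1]; rewrite ger0_norm// ler_piMl.
exfalso; apply: Gw.
have -> : w = p 1 by rewrite /p scale1r addrC subrK.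
have H : `[(0:R), 1]%classic `&` p @^-1` G = `[0, 1]%classic.
  apply: (@segment_connected R 0 1).
  - by exists 0; split => /=; rewrite ?in_itv/= ?lexx ?ler01// /p scale0r addr0.
  - by exists (p @^-1` G) => //; apply: open_comp => // y _; exact: cp.
  - exists (p @^-1` closure G).
      by apply: preimage_closed; [move=> y _; exact: cp|exact: closed_closure].
    rewrite predeqE => t; split => -[/= t01 Gt]; split => //.
      exact: subset_closure.
    by apply: contrapT => nGt; apply: noz; exists t.
suff [] : (`[(0:R), 1]%classic `&` p @^-1` G) 1 by [].
by rewrite H/= in_itv/= ler01 lexx.
Qed.

Lemma boundary_nonempty G x : open G -> G x -> G <> setT ->
  boundary G !=set0.
Proof.
move=> oG Gx GT; have [w Gw] : exists w, ~ G w.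
  by apply/existsNP => GA; apply: GT; rewrite predeqE.
by have [z bz _] := segment_meets_boundary oG Gx Gw; exists z.
Qed.

Lemma bdist_has_lbound G x : has_lbound [set `|x - y| | y in boundary G].
Proof. by exists 0 => _ [y _ <-]. Qed.

Lemma bdist_le G x z : boundary G z -> bdist G x <= `|x - z|.
Proof. by move=> bz; apply: ge_inf; [exact: bdist_has_lbound|exists z]. Qed.

Lemma bdist_lip G x y : bdist G x <= bdist G y + `|x - y|.
Proof.
have [[z0 bz0]|/nonemptyPn b0] := pselect (boundary G !=set0); last first.
  by rewrite /bdist b0 !image_set0 inf0 add0r.
rewrite -lerBlDr; apply: lb_le_inf; first by exists `|y - z0|, z0.
move=> _ [z bz <-]; rewrite lerBlDr (le_trans (bdist_le x bz))//.
by rewrite [leRHS]addrC ler_distD.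
Qed.

Lemma bdist_gt0 G x : open G -> G <> setT -> G x -> 0 < bdist G x.
Proof.
move=> oG GT Gx; have [z0 bz0] := boundary_nonempty oG Gx GT.
have /nbhs_ballP[r /= r0 rG] : nbhs x G by exact: open_nbhs_nbhs.
rewrite (lt_le_trans r0)//; apply: lb_le_inf; first by exists `|x - z0|, z0.
move=> _ [z [_ Gz] <-]; rewrite leNgt; apply/negP => xz; apply: Gz.
by apply: rG; rewrite -ball_normE.
Qed.

Lemma ball_bdist_subset G x y : open G -> G x -> `|x - y| < bdist G x -> G y.
Proof.
move=> oG Gx xy; apply: contrapT => Gy.
have [z bz xz] := segment_meets_boundary oG Gx Gy.
by have := le_lt_trans (le_trans (bdist_le x bz) xz) xy; rewrite ltxx.
Qed.

Lemma boundary_almost_nearest G x : open G -> G <> setT -> G x ->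
  exists2 z, boundary G z & `|x - z| <= 2 * bdist G x.
Proof.
move=> oG GT Gx; have [z0 bz0] := boundary_nonempty oG Gx GT.
have d0 := bdist_gt0 oG GT Gx.
have [|_ [z bz <-] xz] :=
    @inf_adherent _ [set `|x - y| | y in boundary G] _ d0.
  by split; [exists `|x - z0|, z0|exact: bdist_has_lbound].
by exists z => //; rewrite mulr_natl mulr2n ltW.
Qed.

End BoundaryDistance.

(** * Length of curves *)

(** Non-strict inequalities between functions continuous on [A] survive at the
    points of [A] adherent to the set where they hold.  Limits of lengths
    and chords are taken in this form below. *)
Lemma within_closure_ge0 {T : topologicalType} {R : realType} (A S : set T)
    (F : T -> R) (x : T) : {within A, continuous F} -> S `<=` A -> A x ->
  closure S x -> (forall t, S t -> 0 <= F t) -> 0 <= F x.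
Proof.
move=> /subspace_continuousP cF SA Ax Sx F0; rewrite leNgt; apply/negP => Fx.
have /(_ _)/Sx[|t [St /= FtA]] := cF x Ax [set y | y < 0].
  exact: lt_nbhsl.
by have := F0 t St; rewrite leNgt FtA//; exact: SA.
Qed.

Lemma closure_inf {R : realType} (S : set R) :
  has_inf S -> closure S (inf S).
Proof.
move=> iS B /nbhs_ballP[e /= e0 eB]; have [t St tS] := inf_adherent e0 iS.
exists t; split=> //; apply: eB; rewrite -ball_normE /= distrC ger0_norm.
  by rewrite ltrBlDl.
by rewrite subr_ge0; apply: ge_inf => //; case: iS.
Qed.

Lemma closure_sup {R : realType} (S : set R) :
  has_sup S -> closure S (sup S).
Proof.
move=> iS B /nbhs_ballP[e /= e0 eB]; have [t St tS] := sup_adherent e0 iS.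
exists t; split=> //; apply: eB; rewrite -ball_normE /= ger0_norm.
  by rewrite ltrBlDr -ltrBlDl.
by rewrite subr_ge0; apply: ub_le_sup => //; case: iS.
Qed.

Lemma closure_ltI {R : realType} (S : set R) (x y : R) :
  x < y -> closure S x -> closure (S `&` [set t | t < y]) x.
Proof.
move=> xy Sx B Bx; have [|t [St [Bt ty]]] := Sx (B `&` [set t | t < y]).
  by apply: filterI => //; exact: lt_nbhsl.
by exists t.
Qed.

Lemma closure_gtI {R : realType} (S : set R) (x y : R) :
  y < x -> closure S x -> closure (S `&` [set t | y < t]) x.
Proof.
move=> xy Sx B Bx; have [|t [St [Bt ty]]] := Sx (B `&` [set t | y < t]).
  by apply: filterI => //; exact: lt_nbhsr.
by exists t.
Qed.

Lemma closure_itvco {R : realType} (a x : R) :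
  a < x -> closure [set t | a <= t < x] x.
Proof.
move=> ax B /nbhs_ballP[e /= e0 eB]; exists (Num.max a (x - e / 2)); split.
  by rewrite /= le_max lexx/= gt_max ax ltrBlDr ltrDl divr_gt0.
apply: eB; rewrite -ball_normE /= ger0_norm.
  rewrite ltrBlDl -ltrBlDr lt_max; apply/orP; right.
  by rewrite ltrD2l ltrN2 ltr_pdivrMr// ltr_pMr// ltr1n.
by rewrite subr_ge0 ge_max (ltW ax) gerBl divr_ge0// ltW.
Qed.

Section CurveLength.
Context {R : realType} {E : normedModType R}.
Implicit Types (g : R -> E) (a b p t : R) (s : seq R).

Fixpoint variation_sum g a s : R :=
  if s is x :: s' then `|g x - g a| + variation_sum g x s' else 0.

Lemma variation_sumE g a b s :
  \sum_(0 <= n < size s)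
     `|g (nth b (a :: s) n.+1) - g (nth b (a :: s) n)| = variation_sum g a s.
Proof.
elim: s a => [|x s IH] a /=; first by rewrite big_nil.
by rewrite big_nat_recl//= -IH.
Qed.

Lemma curve_lengthE a b g : curve_length a b g =
  ereal_sup [set (variation_sum g a s)%:E | s in itv_partition a b].
Proof.
by congr ereal_sup; apply: eq_imagel => s _; rewrite variation_sumE.
Qed.

Lemma variation_sum_cat g a s1 s2 : variation_sum g a (s1 ++ s2) =
  variation_sum g a s1 + variation_sum g (last a s1) s2.
Proof. by elim: s1 a => [|x s IH] a /=; rewrite ?add0r// IH addrA. Qed.

Lemma variation_sum_le_length a b g s : itv_partition a b s ->
  ((variation_sum g a s)%:E <= curve_length a b g)%E.
Proof. by move=> abs; rewrite curve_lengthE; apply: ereal_sup_ubound; exists s. Qed.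

Lemma curve_length_le a b g (x : \bar R) :
  (forall s, itv_partition a b s -> ((variation_sum g a s)%:E <= x)%E) ->
  (curve_length a b g <= x)%E.
Proof.
by move=> H; rewrite curve_lengthE; apply: ge_ereal_sup => _ [s /H + <-].
Qed.

Lemma curve_lengthxx a g : curve_length a a g = 0%E.
Proof.
apply/eqP; rewrite eq_le; apply/andP; split.
  by apply: curve_length_le => s /itv_partitionxx ->.
by apply: (@variation_sum_le_length a a g [::]); split => /=.
Qed.

Lemma variation_sum_chord_le a p t g s : itv_partition a p s -> p <= t ->
  ((variation_sum g a s + `|g t - g p|)%:E <= curve_length a t g)%E.
Proof.
move=> aps; rewrite le_eqVlt => /predU1P[<-|pt].
  by rewrite subrr normr0 addr0 variation_sum_le_length.
have := variation_sum_le_length g (itv_partition_cat aps (itv_partition1 pt)).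
by case: aps => _ /eqP <-; rewrite variation_sum_cat /= addr0.
Qed.

Lemma curve_lengthD_chord a p t g : p <= t ->
  (curve_length a p g + `|g t - g p|%:E <= curve_length a t g)%E.
Proof.
move=> pt; rewrite -leeBrDr//; apply: curve_length_le => s aps.
by rewrite leeBrDr// -EFinD variation_sum_chord_le.
Qed.

Lemma curve_length_mono a p t g : p <= t ->
  (curve_length a p g <= curve_length a t g)%E.
Proof.
by move=> pt; rewrite (le_trans _ (curve_lengthD_chord a g pt))// leeDl.
Qed.

Lemma chord_le_length a t g : a <= t ->
  (`|g t - g a|%:E <= curve_length a t g)%E.
Proof.
by move=> /(curve_lengthD_chord a g); rewrite curve_lengthxx add0e.
Qed.

Lemma curve_length_ge0 a t g : a <= t -> (0 <= curve_length a t g)%E.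
Proof. by move=> /(chord_le_length g); apply: le_trans; rewrite lee_fin. Qed.

Lemma variation_sum_rev g a s : variation_sum (g \o -%R) (- last a s)
  (rev (belast (- a) [seq - i | i <- s])) = variation_sum g a s.
Proof.
elim: s a => [//|x s IH] a /=.
rewrite rev_cons -cats1 variation_sum_cat IH /= addr0 addrC; congr (_ + _).
rewrite (_ : last _ _ = - x); last first.
  by case: s {IH} => [//|y s] /=; rewrite rev_cons last_rcons.
by rewrite /= !opprK distrC.
Qed.

Lemma curve_length_rev a b g :
  curve_length (- b) (- a) (g \o -%R) = curve_length a b g.
Proof.
have le a' b' g' : (curve_length a' b' g' <=
    curve_length (- b') (- a') (g' \o -%R))%E.
  apply: curve_length_le => s abs.
  have -> : variation_sum g' a' s = variation_sum (g' \o -%R) (- b')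
      (rev (belast (- a') [seq - i | i <- s])).
    by case: abs => _ /eqP <-; rewrite variation_sum_rev.
  exact/variation_sum_le_length/itv_partition_rev.
apply/eqP; rewrite eq_le le andbT.
rewrite (le_trans (le _ _ _))// !opprK.
by rewrite (_ : (g \o _) \o _ = g)//; apply/funext => t /=; rewrite opprK.
Qed.

Lemma within_continuous_chord (A : set R) g (x : E) :
  {within A, continuous g} -> {within A, continuous (fun t => `|g t - x|)}.
Proof.
move=> cg t; apply: (@continuous_comp (subspace A) E R g (fun z => `|z - x|)).
  exact: cg.
by apply: continuous_comp; [apply: cvgB; [exact: cvg_id|exact: cvg_cst]|
  exact: norm_continuous].
Qed.

(** Lower semicontinuity of [t |-> curve_length a t g] from the left: a given
    partition of [a, t0] is almost one of [a, t] for [t] close to [t0]. *)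
Lemma curve_length_left_lsc a b g (phi : R -> R) (S : set R) t0 :
  {within `[a, b], continuous g} -> {within `[a, b], continuous phi} ->
  S `<=` [set t | a <= t < t0] -> t0 <= b -> closure S t0 ->
  (forall t, S t -> (curve_length a t g <= (phi t)%:E)%E) ->
  (curve_length a t0 g <= (phi t0)%:E)%E.
Proof.
move=> cg cphi Sa t0b St0 Sphi; apply: curve_length_le => s.
have [t St] : S !=set0 by have [t [St _]] := St0 _ filterT; exists t.
have /andP[at_ tt0] := Sa t St.
case/lastP: s => [/itv_partition_nil at0|s x].
  by move: tt0; rewrite -at0 ltNge at_.
move=> [+ /eqP]; rewrite last_rcons => + xt0; rewrite {x}xt0 rcons_path.
move=> /andP[pas]; set p := last a s => pt0.
have asp : itv_partition a p s by split => //; rewrite eqxx.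
rewrite -cats1 variation_sum_cat /= addr0 -/p lee_fin -subr_ge0.
pose F t := phi t - (variation_sum g a s + `|g t - g p|).
apply: (@within_closure_ge0 _ _ _ _ F _ _ _ _ (closure_gtI pt0 St0)).
- move=> y; apply: cvgB; first exact: cphi.
  by apply: cvgD; [exact: cvg_cst|exact: within_continuous_chord].
- move=> y [/Sa/andP[ay yt0] _] /=; rewrite in_itv/= ay/=.
  by rewrite (le_trans (ltW yt0)).
- by rewrite /= in_itv/= t0b (le_trans at_) // ltW.
- move=> y [Sy /= py]; rewrite subr_ge0 -lee_fin (le_trans _ (Sphi y Sy))//.
  by rewrite variation_sum_chord_le// ltW.
Qed.

End CurveLength.

(** * Parametrization by arc length *)

Section ArcLength.
Context {R : realType} {E : normedModType R}.

(** A parametrization of speed at most one: it is continuous, and each part of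
    the path is no longer than its parameter interval, so that later
    constructions need not mention [curve_length]. *)
Definition lip1 (L : R) (sigma : R -> E) : Prop :=
  forall u v, 0 <= u -> u <= v -> v <= L -> `|sigma v - sigma u| <= v - u.

Section Rectifiable.
Variables (a b : R) (g : R -> E).
Hypotheses (ab : a <= b) (cg : {within `[a, b], continuous g}).
Hypothesis rg : rectifiable a b g.
Let L : R := fine (curve_length a b g).
Let reach (u : R) : set R :=
  [set t | t \in `[a, b] /\ (u%:E <= curve_length a t g)%E].
Let tau (u : R) : R := inf (reach u).

Let LE : curve_length a b g = L%:E.
Proof. by rewrite fineK// ge0_fin_numE// curve_length_ge0. Qed.

Lemma arclength_ge0 : 0 <= L.
Proof. by rewrite -lee_fin -LE curve_length_ge0. Qed.

Let reach_ab u : reach u `<=` `[a, b].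
Proof. by move=> t []. Qed.

Let reach_b u : u <= L -> reach u b.
Proof. by move=> uL; split; rewrite ?in_itv/= ?ab ?lexx// LE lee_fin. Qed.

Let has_inf_reach u : u <= L -> has_inf (reach u).
Proof.
move=> uL; split; first by exists b; exact: reach_b.
by exists a => t [+ _]; rewrite in_itv/= => /andP[].
Qed.

Let closure_tau u : u <= L -> closure (reach u) (tau u).
Proof. by move=> uL; apply/closure_inf/has_inf_reach. Qed.

Lemma arclength_time_in u : u <= L -> tau u \in `[a, b].
Proof.
move=> uL; rewrite in_itv/=; apply/andP; split.
  apply: lb_le_inf; first by exists b; exact: reach_b.
  by move=> t [+ _]; rewrite in_itv/= => /andP[].
by apply: ge_inf; [case: (has_inf_reach uL)|exact: reach_b].
Qed.

Let length_before_tau u t : u <= L -> a <= t -> t < tau u ->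
  (curve_length a t g < u%:E)%E.
Proof.
move=> uL at_ tu; rewrite ltNge; apply/negP => ut.
have := arclength_time_in uL; rewrite in_itv/= => /andP[_ ub].
suff : tau u <= t by rewrite leNgt tu.
apply: ge_inf; first by case: (has_inf_reach uL).
by split=> //; rewrite in_itv/= at_ ltW// (lt_le_trans tu).
Qed.

Let length_tau u : 0 <= u -> u <= L -> (curve_length a (tau u) g <= u%:E)%E.
Proof.
move=> u0 uL; have := arclength_time_in uL.
rewrite in_itv/= => /andP[]; rewrite le_eqVlt => /predU1P[<- _|au ub].
  by rewrite curve_lengthxx lee_fin.
apply: (@curve_length_left_lsc _ _ a b g (fun=> u)
  [set t | a <= t < tau u]) => //.
- by move=> ?; exact: cvg_cst.
- exact: closure_itvco.
- by move=> t /andP[at_ tu]; apply/ltW/length_before_tau.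
Qed.

(** Up to the time [tau v] at most the length [v] is covered, while [u] is
    already exceeded at times arbitrarily close after [tau u]; the chord between
    is bounded by the difference.  The argument does not presuppose that arc
    length is continuous along the curve. *)
Lemma arclength_param_lip1 : lip1 L (arclength_param a b g).
Proof.
move=> u v u0 uv vL; have uL := le_trans uv vL.
rewrite /arclength_param -/(reach u) -/(reach v) -/(tau u) -/(tau v).
have : tau u <= tau v.
  apply: lb_le_inf; first by exists b; exact: reach_b.
  move=> t [tab vt]; apply: ge_inf; first by case: (has_inf_reach uL).
  by split => //; rewrite (le_trans _ vt) // lee_fin.
rewrite le_eqVlt => /predU1P[->|tuv].
  by rewrite subrr normr0 subr_ge0.
rewrite -subr_ge0 distrC.
pose F t := v - u - `|g t - g (tau v)|.
apply: (@within_closure_ge0 _ _ _ _ F _ _ _ _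
  (closure_ltI tuv (closure_tau uL))).
- move=> t; apply: cvgB; first exact: cvg_cst.
  exact: within_continuous_chord.
- by move=> t [/reach_ab].
- exact: arclength_time_in.
- move=> t [[tab ut] /= tv]; rewrite /F subr_ge0 lerBrDl -lee_fin.
  rewrite (le_trans _ (length_tau (le_trans u0 uv) vL))//.
  rewrite (le_trans _ (curve_lengthD_chord a g (ltW tv)))// distrC EFinD.
  by rewrite leeD2r.
Qed.

Lemma arclength_param0 : arclength_param a b g 0 = g a.
Proof.
rewrite /arclength_param; congr g; apply/eqP; rewrite eq_le; apply/andP; split.
  apply: ge_inf; first by case: (has_inf_reach arclength_ge0).
  by split; rewrite ?in_itv/= ?lexx ?ab// curve_lengthxx.
by have := arclength_time_in arclength_ge0; rewrite in_itv/= => /andP[].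
Qed.

Lemma arclength_paramL : arclength_param a b g L = g b.
Proof.
rewrite /arclength_param -/(reach L) -/(tau L).
apply/eqP; rewrite -subr_eq0 -normr_le0 -oppr_ge0.
pose F t := - `|g t - g b|.
apply: (@within_closure_ge0 _ _ `[a, b] _ F _ _ _ _ (closure_tau (lexx L))).
- move=> t; apply: cvgN; exact: within_continuous_chord.
- exact: reach_ab.
- exact/arclength_time_in.
- move=> t [+ Lt]; rewrite in_itv/= => /andP[at_ tb].
  have := curve_lengthD_chord a g tb; rewrite LE => /(le_trans _)-/(_ (L + `|g b - g t|)%:E).
  by rewrite EFinD leeD2r// -EFinD lee_fin gerDl distrC oppr_ge0 => ->.
Qed.

(** The length covered at the time [tau u] is not known to be at least [u], but
    it is at nearby later times, and [phi] is continuous. *)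
Lemma arclength_bound (phi : R -> R) u : {within `[a, b], continuous phi} ->
  (forall t, t \in `[a, b] -> (curve_length a t g <= (phi t)%:E)%E) ->
  0 <= u -> u <= L -> u <= phi (tau u).
Proof.
move=> cphi Hphi u0 uL; rewrite -subr_ge0.
pose F t := phi t - u.
apply: (@within_closure_ge0 _ _ `[a, b] _ F _ _ _ _ (closure_tau uL)).
- by move=> t; apply: cvgB; [exact: cphi|exact: cvg_cst].
- exact: reach_ab.
- exact/arclength_time_in.
- by move=> t [/Hphi + ut]; rewrite subr_ge0 -lee_fin; apply: le_trans.
Qed.

End Rectifiable.

Lemma lip1_norm L (sigma : R -> E) u v : lip1 L sigma -> u \in `[0, L] ->
  v \in `[0, L] -> `|sigma u - sigma v| <= `|u - v|.
Proof.
move=> ls; rewrite !in_itv/= => /andP[u0 uL] /andP[v0 vL].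
have [uv|/ltW vu] := leP u v; last by rewrite [leRHS]ger0_norm ?subr_ge0// ls.
by rewrite distrC [leRHS]distrC [leRHS]ger0_norm ?subr_ge0// ls.
Qed.

Lemma lip1_within_continuous L (sigma : R -> E) :
  lip1 L sigma -> {within `[0, L], continuous sigma}.
Proof.
move=> ls; apply/subspace_continuousP => u /= uL; apply/cvgrPdist_lt => e e0.
rewrite near_withinE; near=> v => vL.
rewrite (le_lt_trans (lip1_norm ls uL vL))//.
Unshelve. all: by end_near. Qed.

Lemma lip1_curve_length L (sigma : R -> E) u v : lip1 L sigma ->
  0 <= u -> u <= v -> v <= L -> (curve_length u v sigma <= (v - u)%:E)%E.
Proof.
move=> ls u0 uv vL; apply: curve_length_le => s [].
rewrite lee_fin; elim: s u u0 {uv} => [u _ _ /eqP /= ->|x s IH u u0 /=].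
  by rewrite subrr.
move=> /andP[ux xs] lxs; have x0 := le_trans u0 (ltW ux).
have xv : x <= v by exact: (itv_partition_le (conj xs lxs)).
have := lerD (ls _ _ u0 (ltW ux) (le_trans xv vL)) (IH x x0 xs lxs).
by rewrite [in X in _ <= X -> _]addrC addrA subrK.
Qed.

End ArcLength.

(** * The John condition in terms of carrots *)

Section Carrots.
Context {R : realType} {E : normedModType R}.
Implicit Types (G : set E) (g sigma : R -> E) (x y : E).

Definition path_cat (L : R) sigma1 sigma2 (u : R) : E :=
  if u <= L then sigma1 u else sigma2 (u - L).

Lemma path_catP L1 L2 sigma1 sigma2 u : u \in `[0, L1 + L2] ->
  (u \in `[0, L1] /\ path_cat L1 sigma1 sigma2 u = sigma1 u) \/
  (u - L1 \in `[0, L2] /\ path_cat L1 sigma1 sigma2 u = sigma2 (u - L1)).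
Proof.
rewrite !in_itv/= => /andP[u0 uL]; rewrite /path_cat; case: ifPn => uL1.
  by left; rewrite u0.
by right; split => //; move: uL1; rewrite -ltNge => uL1; apply/andP; split; lra.
Qed.

Lemma path_catL L1 L2 sigma1 sigma2 : 0 <= L2 -> sigma1 L1 = sigma2 0 ->
  path_cat L1 sigma1 sigma2 (L1 + L2) = sigma2 L2.
Proof.
move=> L20 s12; rewrite /path_cat; case: ifPn => [L12|_]; last first.
  by rewrite addrC addKr.
have -> : L2 = 0 by lra.
by rewrite addr0.
Qed.

Lemma lip1_cat L1 L2 sigma1 sigma2 : 0 <= L1 -> lip1 L1 sigma1 ->
  lip1 L2 sigma2 -> sigma1 L1 = sigma2 0 ->
  lip1 (L1 + L2) (path_cat L1 sigma1 sigma2).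
Proof.
move=> L10 l1 l2 s12 u v u0 uv vL; rewrite /path_cat.
case: ifPn => vL1; first by rewrite (le_trans uv vL1); apply: l1.
rewrite -ltNge in vL1; case: ifPn => uL1.
  rewrite (le_trans (ler_distD (sigma1 L1) _ _))//.
  have := lerD (l2 0 (v - L1) (lexx _) _ _) (l1 u L1 u0 uL1 (lexx _)).
  by rewrite s12 => /(_ _ _)/le_trans; apply; lra.
rewrite -ltNge in uL1.
by rewrite (le_trans (l2 (u - L1) (v - L1) _ _ _))//; lra.
Qed.

Lemma lip1_rev L sigma : lip1 L sigma -> lip1 L (fun u => sigma (L - u)).
Proof.
move=> ls u v u0 uv vL; rewrite distrC.
by rewrite (le_trans (ls (L - v) (L - u) _ _ _))//; lra.
Qed.

(** One half of the John condition: a length carrot, with tip [x]. *)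
Definition carrot (c : R) G x y : Prop :=
  exists (L : R) sigma, [/\ 0 <= L, lip1 L sigma, sigma 0 = x, sigma L = y &
    forall u, u \in `[0, L] -> G (sigma u) /\ u <= c * bdist G (sigma u)].

Lemma within_continuous_bdist G (A : set R) g :
  {within A, continuous g} -> {within A, continuous (fun t => bdist G (g t))}.
Proof.
move=> cg t.
apply: (@continuous_comp (subspace A) E R g (bdist G)); first exact: cg.
apply/cvgrPdist_lt => e e0; near=> z.
have zt : `|g t - z| < e by near: z; exact: cvgr_dist_lt.
rewrite (le_lt_trans _ zt)// ler_norml.
have := bdist_lip G (g t) z; have := bdist_lip G z (g t).
by rewrite (distrC z) => *; apply/andP; split; lra.
Unshelve. all: by end_near. Qed.

Lemma within_continuous_scaled_bdist G (A : set R) g (c : R) :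
  {within A, continuous g} ->
  {within A, continuous (fun t => c * bdist G (g t))}.
Proof.
move=> cg t; apply: cvgM; first exact: cvg_cst.
exact: within_continuous_bdist.
Qed.

Lemma carrot_of_curve (a b c : R) g G : a <= b ->
  {within `[a, b], continuous g} -> (forall t, t \in `[a, b] -> G (g t)) ->
  (forall t, t \in `[a, b] ->
    (curve_length a t g <= (c * bdist G (g t))%:E)%E) ->
  carrot c G (g a) (g b).
Proof.
move=> ab cg Gg gc.
have rg : rectifiable a b g.
  by rewrite /rectifiable (le_lt_trans (gc b _)) ?ltry// in_itv/= ab lexx.
exists (fine (curve_length a b g)), (arclength_param a b g).
split; [exact: arclength_ge0|exact: arclength_param_lip1|
  exact: arclength_param0|exact: arclength_paramL|].
move=> u; rewrite in_itv/= => /andP[u0 uL]; split.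
  by apply: Gg; apply: arclength_time_in.
apply: (arclength_bound ab rg (phi := fun t => c * bdist G (g t))) => //.
exact: within_continuous_scaled_bdist.
Qed.

(** Where only the distance to [g b] is known to be small, the length from [a]
    is at most the total length, hence at most [c] times the distance of [g b]
    to the boundary, which is at most [1 + c] times that of [g t]. *)
Lemma carrot_of_half (a b c : R) g G : 0 <= c -> a <= b ->
  {within `[a, b], continuous g} -> (forall t, t \in `[a, b] -> G (g t)) ->
  (curve_length a b g <= (c * bdist G (g b))%:E)%E ->
  (forall t, t \in `[a, b] ->
    (curve_length a t g <= (c * bdist G (g t))%:E)%E \/
    `|g b - g t| <= c * bdist G (g t)) ->
  (forall t, t \in `[a, b] -> 0 <= bdist G (g t)) ->
  carrot (c * (1 + c)) G (g a) (g b).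
Proof.
move=> c0 ab cg Gg gb gt d0; apply: carrot_of_curve => // t tab.
have := d0 t tab; have [at_c|tb_c] := gt t tab => d0t.
  rewrite (le_trans at_c)// lee_fin -mulrA ler_wpM2l//.
  by rewrite mulrDl mul1r lerDl mulr_ge0.
move: tab; rewrite in_itv/= => /andP[at_ tb].
rewrite (le_trans (curve_length_mono a g tb))// (le_trans gb)// lee_fin -mulrA.
rewrite ler_wpM2l// mulrDl mul1r (le_trans (bdist_lip G _ (g t)))//.
by rewrite lerD2l.
Qed.

(** The John curve from [x1] to [x2] is cut at the last parameter where it is
    still short seen from [x1].  By lower semicontinuity of length it is short
    seen from both ends there. *)
Lemma John_carrots c G x1 x2 : 0 <= c -> (forall x, G x -> 0 <= bdist G x) ->
  length_cJohn c G -> G x1 -> G x2 ->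
  exists y, carrot (c * (1 + c)) G x1 y /\ carrot (c * (1 + c)) G x2 y.
Proof.
move=> c0 d0 JG Gx1 Gx2; have [a [b [g [[ab cg Gg gx1 gx2] gmin]]]] := JG _ _ Gx1 Gx2.
pose S : set R :=
  [set t | t \in `[a, b] /\ (curve_length a t g <= (c * bdist G (g t))%:E)%E].
have aab : a \in `[a, b] by rewrite in_itv/= lexx.
have Sa : S a.
  split => //; rewrite curve_lengthxx lee_fin mulr_ge0//.
  exact/d0/Gg.
have sS : has_sup S.
  by split; [exists a|exists b => t [+ _]; rewrite in_itv/= => /andP[]].
pose t0 := sup S.
have S_le t : S t -> t <= t0 by move=> St; apply: ub_le_sup => //; case: sS.
have at0 : a <= t0 by exact: S_le.
have t0b : t0 <= b.
  by apply: ge_sup; [exists a|move=> t [+ _]; rewrite in_itv/= => /andP[]].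
have t0ab : t0 \in `[a, b] by rewrite in_itv/= at0.
have cphi := within_continuous_scaled_bdist (c := c) (G := G) cg.
have left_t0 : (curve_length a t0 g <= (c * bdist G (g t0))%:E)%E.
  have [[]//|St0] := pselect (S t0).
  (* [S] then lies strictly before its supremum and accumulates there. *)
  apply: (@curve_length_left_lsc _ _ a b g (fun t => c * bdist G (g t)) S) => //.
  - move=> t St; have [+ _] := St; rewrite /= in_itv/= => /andP[-> _] /=.
    by rewrite lt_neqAle S_le// andbT; apply/eqP => tt0; apply: St0; rewrite -tt0.
  - exact: closure_sup.
  - by move=> t [].
have cN : continuous (-%R : R -> R) by move=> t; exact: opp_continuous.
have Nab t : t \in `[- b, - a] -> - t \in `[a, b].
  by rewrite !in_itv/= lerNl andbC lerNr.
have cNg : {within `[- b, - a], continuous (g \o -%R)}.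
  apply/subspace_continuousP => t /Nab tab.
  have /subspace_continuousP/(_ _ tab)/cvgrPdist_lt gt := cg.
  apply/cvgrPdist_lt => e /gt; rewrite near_withinE => /cN gte.
  rewrite near_withinE; have {}gte : nbhs t (fun s =>
    - s \in `[a, b] -> `|g (- t) - g (- s)| < e) := gte.
  by apply: filterS gte => s gts /Nab/gts.
have right_t0 : (curve_length t0 b g <= (c * bdist G (g t0))%:E)%E.
  move: t0b; rewrite le_eqVlt => /predU1P[->|t0b].
    rewrite curve_lengthxx lee_fin mulr_ge0//; apply/d0/Gg.
    by rewrite in_itv/= ab lexx.
  rewrite -curve_length_rev.
  (* After [t0] the curve is short seen from [b]; read it backwards. *)
  have := @curve_length_left_lsc _ _ (- b) (- a) (g \o -%R)
    (fun t => c * bdist G (g (- t))) [set t | - b <= t < - t0] (- t0) cNg.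
  rewrite opprK; apply.
  - exact: (within_continuous_scaled_bdist (c := c) (G := G) cNg).
  - by [].
  - by rewrite lerN2.
  - by apply: closure_itvco; rewrite ltrN2.
  - move=> t /andP[bt tt0]; rewrite -{1}[t]opprK curve_length_rev.
    have tab : - t \in `[a, b].
      by apply: Nab; rewrite in_itv/= bt (le_trans (ltW tt0))// lerN2.
    have := gmin _ tab; rewrite ge_min => /orP[St|//].
    suff : - t <= t0 by rewrite lerNl leNgt tt0.
    exact: S_le.
have d0ab t : t \in `[a, b] -> 0 <= bdist G (g t) by move=> /Gg/d0.
exists (g t0); split.
- have sub t : t \in `[a, t0] -> t \in `[a, b].
    by rewrite !in_itv/= => /andP[-> tt0]; exact: le_trans t0b.
  rewrite -gx1; apply: carrot_of_half => //.
  + exact: continuous_subspaceW cg.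
  + by move=> t /sub/Gg.
  + move=> t tt0; have := gmin t (sub t tt0); rewrite ge_min => /orP[|tb].
      by left.
    move: tt0; rewrite in_itv/= => /andP[at_ tt0]; right.
    rewrite -lee_fin (le_trans _ tb)// (le_trans (chord_le_length g tt0))//.
    exact: curve_length_mono.
  + by move=> t /sub/d0ab.
- have sub t : t \in `[- b, - t0] -> - t \in `[a, b].
    rewrite !in_itv/= lerNl lerNr => /andP[-> t0t].
    by rewrite (le_trans at0).
  have := @carrot_of_half (- b) (- t0) c (g \o -%R) G c0.
  rewrite /= !opprK gx2; apply.
  + by rewrite lerN2.
  + apply: continuous_subspaceW cNg => t /=; rewrite !in_itv/= => /andP[->].
    by move=> /le_trans; apply; rewrite lerN2.
  + by move=> t /sub/Gg.
  + by rewrite curve_length_rev.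
  + move=> t tt0; have := gmin _ (sub t tt0); rewrite ge_min => /orP[ta|tb].
      move: tt0; rewrite in_itv/= lerNr => /andP[_ t0t]; right.
      rewrite -lee_fin (le_trans _ ta)// distrC.
      rewrite (le_trans _ (curve_lengthD_chord a g t0t))//.
      by rewrite leeDr// curve_length_ge0.
    by left; rewrite -{1}[t]opprK curve_length_rev.
  + by move=> t /sub/d0ab.
Qed.

Lemma carrots_John c G x1 x2 y : carrot c G x1 y -> carrot c G x2 y ->
  exists a b g, curve_joining G x1 x2 a b g /\
    forall t, t \in `[a, b] ->
      (Order.min (curve_length a t g) (curve_length t b g)
         <= (c * bdist G (g t))%:E)%E.
Proof.
move=> [L1 [s1 [L10 l1 s10 s1L c1]]] [L2 [s2 [L20 l2 s20 s2L c2]]].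
pose s2' u := s2 (L2 - u).
have s12 : s1 L1 = s2' 0 by rewrite /s2' subr0 s1L s2L.
have l12 := lip1_cat L10 l1 (lip1_rev l2) s12.
exists 0, (L1 + L2), (path_cat L1 s1 s2').
have Lu u : u \in `[0, L2] -> L2 - u \in `[0, L2].
  by rewrite !in_itv/= => /andP[u0 uL]; apply/andP; split; lra.
split; first split.
- exact: addr_ge0.
- exact: lip1_within_continuous.
- by move=> u /(path_catP s1 s2')[[/c1[Gu _] ->]|[/Lu/c2[Gu _] ->]].
- by rewrite /path_cat L10.
- by rewrite path_catL// /s2' subrr.
- move=> u uL; have := uL; rewrite in_itv/= => /andP[u0 uL12]; rewrite ge_min.
  have [[/c1[_ cu] ->]|[/Lu/c2[_ cu] ->]] := path_catP s1 s2' uL.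
    rewrite (le_trans (lip1_curve_length l12 _ _ _)) ?subr0 ?lee_fin//.
  apply/orP; right; rewrite (le_trans (lip1_curve_length l12 _ _ _))// lee_fin.
  by rewrite (le_trans _ cu)//; lra.
Qed.

End Carrots.

(** * Quasihyperbolic distance *)

Section Quasihyperbolic.
Context {R : realType} {E : normedModType R}.
Implicit Types (G : set E) (sigma : R -> E) (x y : E).

Lemma affine_gt0 (m s L u : R) : 0 < m -> 0 < m + s * L -> 0 <= u -> u <= L ->
  0 < m + s * u.
Proof.
move=> m0 mL0 u0 uL; have [s0|/ltW s0] := leP 0 s.
  by rewrite ltr_wpDr// mulr_ge0.
by rewrite (lt_le_trans mL0)// lerD2l ler_wnM2l.
Qed.

Lemma within_continuous_inv_affine (m s L : R) : 0 < m -> 0 < m + s * L ->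
  {within `[0, L], continuous (fun u : R => (m + s * u)^-1)}.
Proof.
move=> m0 mL0; apply/subspace_continuousP => u; rewrite /= in_itv/=.
move=> /andP[u0 uL]; apply: cvgV; first by rewrite gt_eqF// (affine_gt0 m0 mL0).
apply: (@cvg_within_filter _ _ (fun u : R => m + s * u)).
apply: cvgD; first exact: cvg_cst.
by apply: cvgM; [exact: cvg_cst|exact: cvg_id].
Qed.

(** Stated for slopes [s] of both signs, to treat at once the distance from the
    starting point of a path and the distance to its end point. *)
Lemma integral_inv_affine (m s L : R) : s ^+ 2 = 1 -> 0 <= L -> 0 < m ->
  0 < m + s * L ->
  (\int[lebesgue_measure]_(u in `[0%R, L]) ((m + s * u)^-1)%:E)%E =
    (s * (ln (m + s * L) - ln m))%:E.
Proof.
move=> s2 L0 m0 mL0; move: L0; rewrite le_eqVlt => /predU1P[<-|L0].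
  by rewrite set_itv1 integral_set1 mulr0 addr0 subrr mulr0.
have pos u := @affine_gt0 m s L u m0 mL0.
have dF u : 0 <= u -> u <= L ->
    is_derive u (1 : R) (fun t => s * ln (m + s * t)) ((m + s * u)^-1).
  move=> u0 uL; have mu := pos u u0 uL.
  have dm : is_derive u (1 : R) (fun t : R => m + s * t) s.
    apply: is_derive_eq.
    by rewrite add0r mul1r /GRing.scale/= mulr1.
  have := is_deriveZ s (@is_derive1_comp _ (@ln R)
    (fun t => m + s * t) u _ _ (is_derive1_ln mu) dm).
  by move/is_derive_eq; apply; rewrite /GRing.scale/= mulrCA -expr2 s2 mulr1.
have cF u : 0 <= u -> u <= L -> {for u, continuous (fun t => s * ln (m + s * t))}.
  move=> u0 uL; apply/differentiable_continuous/derivable1_diffP.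
  by have [] := dF u u0 uL.
rewrite (@continuous_FTC2 _ (fun u => (m + s * u)^-1)
  (fun u => s * ln (m + s * u)) 0 L L0).
- by rewrite mulr0 addr0 -EFinB mulrBr.
- exact: within_continuous_inv_affine.
- split.
  + move=> u; rewrite in_itv/= => /andP[u0 uL].
    by have [] := dF u (ltW u0) (ltW uL).
  + by apply: cvg_at_right_filter; apply: cF => //; exact: ltW.
  + by apply: cvg_at_left_filter; apply: cF => //; exact: ltW.
- move=> u; rewrite in_itv/= => /andP[u0 uL].
  by rewrite derive1E; have [_ ->] := dF u (ltW u0) (ltW uL).
Qed.

Lemma lip1_qh_measurable G L sigma : lip1 L sigma ->
  (forall u, u \in `[0, L] -> 0 < bdist G (sigma u)) ->
  measurable_fun `[0, L] (fun u => (bdist G (sigma u))^-1).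
Proof.
move=> ls d0.
apply: subspace_continuous_measurable_fun => //.
move: (lip1_within_continuous ls) => /(within_continuous_bdist (G := G)).
move=> /subspace_continuousP H; apply/subspace_continuousP => u uL.
apply: cvgV; first by rewrite gt_eqF// d0.
exact: H.
Qed.


(** Along the path the distance to the boundary grows at most
    linearly, and decreases at most linearly; as [1/u] is not integrable at
    infinity or at [0], bounded quasihyperbolic length bounds both effects. *)
Lemma qh_length_distortion G L sigma (K : R) : lip1 L sigma -> 0 <= L ->
  (forall u, u \in `[0, L] -> 0 < bdist G (sigma u)) ->
  (\int[lebesgue_measure]_(u in `[0%R, L]) ((bdist G (sigma u))^-1)%:E
     <= K%:E)%E ->
  L <= expR K * bdist G (sigma 0) /\
  forall u, u \in `[0, L] -> bdist G (sigma 0) <= expR K * bdist G (sigma u).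
Proof.
move=> ls L0 d0 intK.
have in0 : 0 \in `[0, L] by rewrite in_itv/= lexx.
(* The integral is compared on [0, v] with that of an affine function. *)
have key (v m s : R) : v \in `[0, L] -> s ^+ 2 = 1 -> 0 < m -> 0 < m + s * v ->
    (forall u, 0 <= u -> u <= v -> bdist G (sigma u) <= m + s * u) ->
    s * (ln (m + s * v) - ln m) <= K.
  rewrite in_itv/= => /andP[v0 vL] s2 m0 mv0 dm; rewrite -lee_fin.
  have sub : `[0, v] `<=` `[0, L]%classic.
    by move=> u /=; rewrite !in_itv/= => /andP[-> /le_trans]; exact.
  have md : measurable_fun `[0, L] (EFin \o (fun u => (bdist G (sigma u))^-1)).
    by apply/measurable_EFinP; apply: lip1_qh_measurable.
  rewrite -integral_inv_affine// (le_trans _ intK)//.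
  apply: (@le_trans _ _
    (\int[lebesgue_measure]_(u in `[0%R, v]) ((bdist G (sigma u))^-1)%:E)%E).
    apply: ge0_le_integral => //=.
    - move=> u; rewrite in_itv/= => /andP[u0 uv]; rewrite lee_fin invr_ge0.
      rewrite (le_trans _ (dm u u0 uv))// ltW// d0// in_itv/= u0.
      exact: le_trans vL.
    - apply/measurable_EFinP.
      have := within_continuous_inv_affine m0 mv0.
      exact: subspace_continuous_measurable_fun.
    - exact: (measurable_funS _ sub md).
    - move=> u; rewrite in_itv/= => /andP[u0 uv]; rewrite lee_fin.
      have du : 0 < bdist G (sigma u) by rewrite d0// in_itv/= u0 (le_trans uv).
      by rewrite lef_pV2 ?posrE// ?dm// (lt_le_trans du)// dm.
  apply: ge0_subset_integral => //= u uL; rewrite lee_fin invr_ge0.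
  exact/ltW/d0.
have from_ln (m v : R) : 0 < m -> 0 < m + v -> ln (m + v) - ln m <= K ->
    m + v <= expR K * m.
  by move=> m0 mv0; rewrite lerBlDr -ler_expR expRD !lnK.
have lin u v : u \in `[0, L] -> v \in `[0, L] ->
    bdist G (sigma u) <= bdist G (sigma v) + `|u - v|.
  move=> uL vL; rewrite (le_trans (bdist_lip G _ (sigma v)))// lerD2l.
  exact: lip1_norm uL vL.
split.
  have m0 := d0 0 in0; have mL0 := ltr_wpDr L0 m0.
  rewrite (le_trans _ (from_ln _ _ m0 mL0 _))//.
    by rewrite lerDr ltW.
  have := @key L (bdist G (sigma 0)) 1; rewrite expr1n !mul1r; apply => //.
    by rewrite in_itv/= L0 lexx.
  move=> u u0 uL; rewrite mul1r (le_trans (lin u 0 _ in0)) ?in_itv/= ?u0//.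
  by rewrite subr0 ger0_norm.
move=> v vL; have m0 := d0 v vL.
have /andP[v0 vL'] : 0 <= v <= L by move: vL; rewrite in_itv.
have mv0 := ltr_wpDr v0 m0.
rewrite (le_trans _ (from_ln _ _ m0 mv0 _))//.
  by rewrite (le_trans (lin 0 v in0 vL))// sub0r normrN ger0_norm.
have := @key v (bdist G (sigma v) + v) (-1).
rewrite sqrrN expr1n !mulN1r addrK opprB; apply => //.
move=> u u0 uv; rewrite mulN1r (le_trans (lin u v _ vL))//.
  by rewrite in_itv/= u0 (le_trans uv).
by rewrite -addrA lerD2l distrC ger0_norm ?subr_ge0.
Qed.

End Quasihyperbolic.
Section Links.
Context {R : realType} {E : normedModType R}.
Variable (G : set E).
Hypotheses (oG : open G) (GT : G <> setT).
Implicit Types (p q r x y : E) (sigma : R -> E).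

(** On a segment this short the density [(bdist G _)^-1] is at most twice its
    value at [x]. *)
Lemma qh_dist_le1 x y : G x -> `|x - y| <= bdist G x / 2 ->
  (qh_dist G x y <= 1)%E.
Proof.
move=> Gx xy; have dx := bdist_gt0 oG GT Gx.
pose l := `|y - x|; pose e := l^-1 *: (y - x); pose g t := x + t *: e.
have le_ : l *: e = y - x.
  have [/eqP|l0] := eqVneq l 0; last by rewrite scalerA divff// scale1r.
  by rewrite /e /l normr_eq0 => /eqP ->; rewrite !scaler0.
have e1 : `|e| <= 1.
  rewrite normrZ normfV normr_id -/l.
  by have [->|l0] := eqVneq l 0; rewrite ?mulr0// mulVf.
have gd s t : g s - g t = (s - t) *: e by rewrite /g opprD addrACA subrr add0r scalerBl.
have l0 : 0 <= l by exact: normr_ge0.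
have lg : lip1 l g.
  move=> s t _ st _; rewrite gd normrZ ger0_norm ?subr_ge0//.
  by rewrite ler_piMr// subr_ge0.
have g0 : g 0 = x by rewrite /g scale0r addr0.
have half t : t \in `[0, l] -> `|x - g t| <= bdist G x / 2.
  rewrite in_itv/= => /andP[t0 tl]; rewrite (le_trans _ xy)// (distrC x y).
  rewrite (le_trans _ tl)// -[leRHS]subr0 distrC -{1}g0.
  by apply: lg.
have dg t : t \in `[0, l] -> bdist G x / 2 <= bdist G (g t).
  by move=> /half gt; have := bdist_lip G x (g t); lra.
have Gg t : t \in `[0, l] -> G (g t).
  move=> /half gt; apply: (ball_bdist_subset oG Gx); rewrite (le_lt_trans gt)//.
  by rewrite ltr_pdivrMr// ltr_pMr// ltr1n.
have cg := lip1_within_continuous lg.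
have leng := lip1_curve_length lg (lexx 0) l0 (lexx l).
have rg : rectifiable 0 l g by rewrite /rectifiable (le_lt_trans leng)// ltry.
apply: (@le_trans _ _ (qh_length G 0 l g)).
  apply: ereal_inf_lbound; exists 0, l, g; split => //; split; first split => //.
    by rewrite /g le_ addrC subrK.
  move=> s t; rewrite !in_itv/= => /andP[s0 sl] /andP[t0 tl] gst.
  have : (s - t) *: e = 0 by rewrite -gd gst subrr.
  have [l_0|ln0] := eqVneq l 0.
    by rewrite l_0 in sl tl; move=> _; lra.
  move=> /eqP; rewrite scaler_eq0 subr_eq0 => /orP[/eqP//|/eqP e0].
  by move: ln0; rewrite /l -le_ e0 scaler0 normr0 eqxx.
set L := fine (curve_length 0 l g).
have LE : L <= l.
  rewrite -lee_fin fineK; first by rewrite (le_trans leng)// subr0.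
  by rewrite ge0_fin_numE// curve_length_ge0.
have ls : lip1 L (arclength_param 0 l g) by exact: arclength_param_lip1.
have tau u : u \in `[0, L] -> exists2 t, t \in `[0, l] &
    arclength_param 0 l g u = g t.
  rewrite in_itv/= => /andP[u0 uL].
  by eexists; [exact: (arclength_time_in l0 rg uL)|].
have d2 : 0 < bdist G x / 2 by rewrite divr_gt0.
have dl u : u \in `[0, L] -> bdist G x / 2 <= bdist G (arclength_param 0 l g u).
  by move=> /tau[t tl ->]; exact: dg.
rewrite /qh_length /line_integral -/L.
apply: (@le_trans _ _ (\int[lebesgue_measure]_(u in `[0%R, L])
  (cst (bdist G x / 2)^-1%:E) u)%E).
  apply: ge0_le_integral => //=.
  - by move=> u uL; rewrite lee_fin invr_ge0 (le_trans (ltW d2))// dl.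
  - apply/measurable_EFinP; apply: lip1_qh_measurable => // u uL.
    by rewrite (lt_le_trans d2)// dl.
  - by move=> u uL; rewrite lee_fin lef_pV2 ?posrE// ?dl// (lt_le_trans d2)// dl.
rewrite integral_cst//= lebesgue_measure_itv/= lte_fin; case: ifPn => [L0|_].
  rewrite -EFinB subr0 -EFinM lee_fin mulrC ler_pdivrMr// mul1r.
  by rewrite (le_trans LE)// /l distrC.
by rewrite mule0.
Qed.

(** The trace of a bounded quasihyperbolic distance that the construction of
    John curves needs.  Unlike the coarse bounds on the distance itself, it can
    be composed and measured along the path. *)
Definition linked (B : R) p q : Prop := exists (L : R) sigma,
  [/\ 0 <= L, lip1 L sigma, sigma 0 = p, sigma L = q &
    L <= B * bdist G p /\
    forall u, u \in `[0, L] ->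
      G (sigma u) /\ bdist G p <= B * bdist G (sigma u)].

(** An almost minimizing arc, parametrized by arc length. *)
Lemma linked_of_qh_dist (K : R) p q :
  (qh_dist G p q <= K%:E)%E -> linked (expR (K + 1)) p q.
Proof.
move=> pqK; have : (qh_dist G p q < (K + 1)%:E)%E.
  by rewrite (le_lt_trans pqK)// lte_fin ltrDl.
move=> /ereal_inf_lt[_ [a [b [g [[[ab cg Gg ga gb] _] rg ->]]]] /ltW gK].
pose L := fine (curve_length a b g); pose sigma := arclength_param a b g.
have Gs u : u \in `[0, L] -> G (sigma u).
  by rewrite in_itv/= => /andP[u0 uL]; apply/Gg/arclength_time_in.
have ls : lip1 L sigma by exact: arclength_param_lip1.
have L0 : 0 <= L by exact: arclength_ge0.
have s0 : sigma 0 = p by rewrite -ga; exact: arclength_param0.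
have [lenL dL] := qh_length_distortion ls L0 (fun u uL => bdist_gt0 oG GT (Gs u uL)) gK.
exists L, sigma; split => //; first by rewrite -gb; exact: arclength_paramL.
by split => [|u uL]; rewrite -s0//; split; [exact: Gs|exact: dL].
Qed.

Lemma linked_refl B p : 1 <= B -> G p -> linked B p p.
Proof.
move=> B1 Gp; have d0 := bdist_gt0 oG GT Gp.
have B0 : 0 <= B by exact: le_trans B1.
exists 0, (fun=> p); split => //.
  by move=> u v _ uv _; rewrite subrr normr0 subr_ge0.
split; first by rewrite mulr_ge0// ltW.
by move=> u _; split => //; rewrite ler_peMl// ltW.
Qed.

Lemma linked_bdist B p q : linked B p q -> bdist G q <= (1 + B) * bdist G p.
Proof.
move=> [L [s [L0 ls s0 sL [LB _]]]].
have := ls 0 L (lexx _) L0 (lexx _); rewrite s0 sL subr0 => qp.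
by have := bdist_lip G q p; rewrite mulrDl mul1r; lra.
Qed.

(** The constant is written so that its iterates are powers of [1 + B]. *)
Lemma linked_trans B1 B2 p q r : 0 <= B1 -> 0 <= B2 ->
  linked B1 p q -> linked B2 q r -> linked ((1 + B1) * (1 + B2) - 1) p r.
Proof.
move=> B10 B20 pq qr; have dq := linked_bdist pq.
have [L1 [s1 [L10 l1 s10 s1L [LB1 c1]]]] := pq.
have [L2 [s2 [L20 l2 s20 s2L [LB2 c2]]]] := qr.
have s12 : s1 L1 = s2 0 by rewrite s1L s20.
have L1in : L1 \in `[0, L1] by rewrite in_itv/= L10 lexx.
have [Gq pq1] := c1 _ L1in; rewrite s1L in Gq pq1.
have pos x : G x -> 0 <= bdist G x by move=> Gx; rewrite ltW// bdist_gt0.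
have B12 : 0 <= B1 * B2 by rewrite mulr_ge0.
exists (L1 + L2), (path_cat L1 s1 s2); split.
- exact: addr_ge0.
- exact: lip1_cat.
- by rewrite /path_cat L10.
- by rewrite path_catL.
split; first by have := ler_wpM2l B20 dq; nra.
move=> u /(path_catP s1 s2)[[/c1[Gu cu] ->]|[/c2[Gu cu] ->]]; split => //.
  by have := pos _ Gu; nra.
by have := pos _ Gu; have := ler_wpM2l B10 cu; nra.
Qed.

Lemma linked_chain B n (p : nat -> E) : 1 <= B -> G (p 0) ->
  (forall i, (i < n)%N -> linked B (p i) (p i.+1)) ->
  linked ((1 + B) ^+ n.+1 - 1) (p 0) (p n).
Proof.
move=> B1 Gp; have B0 : 0 <= B by exact: le_trans B1.
elim: n => [_|n IH pn]; first by rewrite expr1 addrC addKr; exact: linked_refl.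
rewrite exprSr -[X in X * _](subrK 1) [X in X * _]addrC.
apply: (linked_trans _ B0 (IH _) (pn n (leqnn _))).
  by rewrite subr_ge0 exprn_ege1// lerDl.
by move=> i ni; apply: pn; exact: ltnW.
Qed.

End Links.

(** * Relative quasisymmetry *)

(** A homeomorphism of the half-line is monotone, and the decreasing case is
    excluded since the maximum would be at [0]. *)
Lemma halfline_homeomorphism_mono {R : realType} (eta : R -> R) :
  homeomorphism_on [set t : R | 0 <= t] [set t : R | 0 <= t] eta ->
  {in [set t : R | 0 <= t] &, {homo eta : s t / s <= t}}.
Proof.
move=> [g [eta_in g_in ceta _]].
have itvE : [set t : R | 0 <= t] = [set` `[0, +oo[].
  by apply/seteqP; split=> t /=; rewrite in_itv/= andbT.
have inj : {in `[0, +oo[ &, injective eta}.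
  move=> s t; rewrite !in_itv/= !andbT => /eta_in[_ gs] /eta_in[_ gt] st.
  by rewrite -gs -gt st.
rewrite itvE in ceta.
have [inc|dec] := unstable.strict_monotonicW (itv_continuous_inj_mono ceta inj).
  by move=> s t; rewrite !inE /= => s0 t0; apply: inc; rewrite in_itv/= andbT.
have [e0 _] := eta_in 0 (lexx 0).
have [g0 gK] := g_in (eta 0 + 1) (addr_ge0 e0 ler01).
have := dec (g (eta 0 + 1)) 0; rewrite !in_itv/= !andbT lexx => /(_ g0 isT g0).
by rewrite gK gerDl ler10.
Qed.

Section QuasisymmetricDecay.
Context {R : realType} {E E' : normedModType R}.
Variables (G : set E) (G' : set E') (eta : R -> R) (F : E -> E').
Hypotheses (oG : open G) (GT : G <> setT) (oG' : open G') (GT' : G' <> setT).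
Hypothesis eta_homeo :
  homeomorphism_on [set t : R | 0 <= t] [set t : R | 0 <= t] eta.
Hypothesis FG : forall x, G x -> G' (F x).
Hypothesis F_bij : homeomorphism_on (closure G) (closure G') F.
Hypothesis F_boundary : forall z, boundary G z -> boundary G' (F z).
Hypothesis F_boundary_onto :
  forall z', boundary G' z' -> exists2 z, boundary G z & F z = z'.
Hypothesis F_qs : quasisymmetric_rel eta (closure G) (boundary G) F.
Implicit Types (p q x y z : E).

Let eta_ge0 t : 0 <= t -> 0 <= eta t.
Proof. by case: eta_homeo => g [H _ _ _] /H[]. Qed.

Let eta_mono s t : 0 <= s -> s <= t -> eta s <= eta t.
Proof.
move=> s0 st; apply: (halfline_homeomorphism_mono eta_homeo) => //;
by rewrite inE //= (le_trans s0).
Qed.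

Let eta_small (e : R) : 0 < e -> exists r, [/\ 0 < r, r <= 1 & eta r <= e].
Proof.
case: eta_homeo => g [eta_in g_in _ _] e0.
have [g0 gK] := g_in _ (ltW e0).
have gne0 : 0 < g e.
  rewrite lt_neqAle g0 andbT; apply/eqP => ge.
  have [h0 hK] := g_in (e / 2) (divr_ge0 (ltW e0) (ler0n R 2)).
  have := eta_mono (lexx 0) h0; rewrite hK ge gK.
  by rewrite leNgt ltr_pdivrMr// ltr_pMr// ltr1n.
exists (Num.min (g e) 1); split.
- by rewrite lt_min gne0 ltr01.
- by rewrite ge_min lexx orbT.
- rewrite -[leRHS]gK; apply: eta_mono; first by rewrite le_min g0 ler01.
  by rewrite ge_min lexx.
Qed.

(** Without quotients the inequality also covers [x = y], where the triple
    degenerates. *)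
Lemma qs_le x y z (r : R) : closure G x -> closure G y -> closure G z ->
  x <> z -> y <> z -> boundary G x \/ (boundary G y /\ boundary G z) ->
  `|y - x| <= r * `|z - x| -> `|F y - F x| <= eta r * `|F z - F x|.
Proof.
move=> cx cy cz xz yz A yr.
have zx0 : 0 < `|z - x|.
  by rewrite normr_gt0 subr_eq0; apply/eqP => zx; apply: xz.
have r0 : 0 <= r by rewrite -(pmulr_lge0 _ zx0) (le_trans _ yr).
have [->|/eqP xy] := eqVneq x y.
  by rewrite subrr normr0 mulr_ge0// eta_ge0.
have [g [gF _ _ _]] := F_bij.
have Fzx0 : 0 < `|F z - F x|.
  rewrite normr_gt0 subr_eq0; apply/eqP => Fzx; apply: xz.
  by have [_ <-] := gF _ cx; have [_ <-] := gF _ cz; rewrite Fzx.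
have [_ /(_ x y z cx cy cz xy xz yz A)] := F_qs.
rewrite /ratio ler_pdivrMr// => /le_trans; apply; rewrite ler_wpM2r//.
by apply: eta_mono; [rewrite divr_ge0|rewrite ler_pdivrMr].
Qed.

Let closure_boundary z : boundary G z -> closure G z.
Proof. by case. Qed.

Let closure_in x : G x -> closure G x.
Proof. exact: subset_closure. Qed.

Let neq_boundary x z : G x -> boundary G z -> x <> z.
Proof. by move=> Gx [_ Gz] xz; apply: Gz; rewrite -xz. Qed.

(** Compare [z] with a boundary point [y] whose image is almost nearest to
    [F q]: in the triple [(y, z, q)] the ratio is at most [s + 1], as [y] is no
    closer to [q] than the boundary. *)
Lemma image_boundary_dist q z (s : R) : G q -> boundary G z -> 0 <= s ->
  `|q - z| <= s * bdist G q ->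
  `|F q - F z| <= 2 * (1 + eta (s + 1)) * bdist G' (F q).
Proof.
move=> Gq bz s0 qz.
have d'0 := bdist_gt0 oG' GT' (FG Gq).
have e0 : 0 <= eta (s + 1) by rewrite eta_ge0// addr_ge0.
have [_ /F_boundary_onto[y by_ <-] qy] := boundary_almost_nearest oG' GT' (FG Gq).
have [->|/eqP zy] := eqVneq z y.
  by rewrite (le_trans qy)// ler_pM2r// ler_peMr// lerDl.
have zFy : `|F z - F y| <= eta (s + 1) * `|F q - F y|.
  apply: qs_le; auto; [by move/esym; apply: neq_boundary|
    by move/esym; apply: neq_boundary|].
  have := ler_wpM2l s0 (bdist_le q by_).
  have := ler_distD q z y; rewrite (distrC z q) mulrDl mul1r; lra.
rewrite (le_trans (ler_distD (F y) _ _))// (distrC (F y)).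
by have := ler_wpM2l e0 qy; nra.
Qed.

(** A boundary point [z] almost nearest to [p] is the vertex of a triple
    [(z, p, q)] of small ratio, so that [F p] is much closer to [F z] than [F q]
    is; and by [image_boundary_dist] the latter distance is comparable to the
    distance of [F q] to the boundary. *)
Lemma image_bdist_decay (t : R) : 0 <= t -> exists r : R, [/\ 0 < r, r <= 1 &
  forall p q, G p -> G q -> 2 * bdist G p <= r * bdist G q ->
    `|p - q| <= t * bdist G q -> 2 * bdist G' (F p) <= bdist G' (F q)].
Proof.
move=> t0; pose k := 2 * (1 + eta (t + 2)).
have et0 : 0 <= eta (t + 2) by rewrite eta_ge0// addr_ge0.
have k0 : 0 < k by rewrite mulr_gt0// ltr_wpDr.
have k2 : 0 < (2 * k)^-1 by rewrite invr_gt0 mulr_gt0.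
have [r [r0 r1 er]] := eta_small k2.
exists r; split => // p q Gp Gq pq_r pq_t.
have dp := bdist_gt0 oG GT Gp; have dq := bdist_gt0 oG GT Gq.
have d'q := bdist_gt0 oG' GT' (FG Gq).
have [z bz pz] := boundary_almost_nearest oG GT Gp.
have pq : p <> q by move=> pq; move: pq_r; rewrite pq; nra.
have Fp : `|F p - F z| <= eta r * `|F q - F z|.
  apply: qs_le; auto; first by move/esym; apply: neq_boundary.
  by rewrite (le_trans pz)// (le_trans pq_r)// ler_wpM2l ?bdist_le// ltW.
have Fq : `|F q - F z| <= k * bdist G' (F q).
  rewrite (le_trans (@image_boundary_dist q z (t + 1) Gq bz _ _)) ?addr_ge0//.
    rewrite (le_trans (ler_distD p _ _))// mulrDl mul1r (distrC q) lerD//.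
    by rewrite (le_trans pz)// (le_trans pq_r)// ler_piMl// ltW.
  by rewrite -addrA.
have := bdist_le (F p) (F_boundary bz) => d'p.
have : eta r * (k * bdist G' (F q)) <= (2 * k)^-1 * (k * bdist G' (F q)).
  by rewrite ler_wpM2r// mulr_ge0// ltW.
have -> : (2 * k)^-1 * (k * bdist G' (F q)) = bdist G' (F q) / 2.
  by field; rewrite gt_eqF.
have := ler_wpM2l (eta_ge0 (ltW r0)) Fq; lra.
Qed.

End QuasisymmetricDecay.

(** * Images of carrots *)

Section CarrotTransfer.
Context {R : realType} {E E' : normedModType R}.
Variables (G : set E) (G' : set E') (F : E -> E').
Hypotheses (oG : open G) (GT : G <> setT) (oG' : open G') (GT' : G' <> setT).
Hypothesis FG : forall x, G x -> G' (F x).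
Variable B : R.
Hypothesis B1 : 1 <= B.
Hypothesis F_links : forall p q, G p -> G q -> `|p - q| <= bdist G p / 2 ->
  linked G' B (F p) (F q).
Hypothesis F_decay : forall t : R, 0 <= t -> exists r : R, [/\ 0 < r, r <= 1 &
  forall p q, G p -> G q -> 2 * bdist G p <= r * bdist G q ->
    `|p - q| <= t * bdist G q -> 2 * bdist G' (F p) <= bdist G' (F q)].

(** A carrot with its length controlled at the thick end.  With these powers of
    [H] the property is stable under the extension by an [H]-link from [y]
    followed by a doubling of the distance to the boundary: the new length is at
    most [(H ^+ 2 + H) * bdist G' y <= H ^+ 2 * (2 * bdist G' y)]. *)
Let short_carrot (H : R) (x y : E') : Prop := exists (L : R) sigma,
  [/\ 0 <= L, lip1 L sigma, sigma 0 = x, sigma L = y &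
    L <= H ^+ 2 * bdist G' y /\ forall u, u \in `[0, L] ->
      G' (sigma u) /\ u <= H ^+ 2 * (H + 1) * bdist G' (sigma u)].

Let short_carrot_of_link H x y : 1 <= H -> linked G' H x y ->
  short_carrot H x y.
Proof.
move=> H1 [L [s [L0 ls s0 sL [LH dH]]]]; exists L, s.
have H0 : 0 <= H by exact: le_trans H1.
have H20 : 0 <= H ^+ 2 by rewrite exprn_ge0.
have bound u : u \in `[0, L] -> L <= H ^+ 2 * bdist G' (s u).
  by move=> /dH[_ /(ler_wpM2l H0)]; rewrite mulrA -expr2; exact: le_trans.
split => //; split; first by rewrite -sL bound// in_itv/= L0 lexx.
move=> u uL; have [Gu _] := dH u uL; split => //.
have := uL; rewrite in_itv/= => /andP[_ /le_trans]; apply.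
rewrite (le_trans (bound u uL))// ler_wpM2r//.
  exact/ltW/bdist_gt0.
by rewrite ler_peMr// lerDr.
Qed.

Let short_carrot_extend H x y z : 1 <= H -> short_carrot H x y ->
  linked G' H y z -> 2 * bdist G' y <= bdist G' z -> short_carrot H x z.
Proof.
move=> H1 [L1 [s1 [L10 l1 s10 s1L [L1H c1]]]] [L2 [s2 [L20 l2 s20 s2L [L2H c2]]]] yz.
have H0 : 0 <= H by exact: le_trans H1.
have s12 : s1 L1 = s2 0 by rewrite s1L s20.
have L1in : L1 \in `[0, L1] by rewrite in_itv/= L10 lexx.
have [Gy _] := c1 _ L1in; rewrite s1L in Gy.
have dy := bdist_gt0 oG' GT' Gy.
have len : L1 + L2 <= H * (H + 1) * bdist G' y by rewrite expr2 in L1H; nra.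
exists (L1 + L2), (path_cat L1 s1 s2); split.
- exact: addr_ge0.
- exact: lip1_cat.
- by rewrite /path_cat L10.
- by rewrite path_catL.
split.
  rewrite (le_trans len)// expr2 -!mulrA ler_wpM2l//.
  have : H * (2 * bdist G' y) <= H * bdist G' z by rewrite ler_wpM2l.
  nra.
move=> u uL; have := uL; rewrite in_itv/= => /andP[_ uL12].
have [[/c1[Gu cu] ->]|[/c2[Gu cu] ->]] := path_catP s1 s2 uL; split => //.
rewrite (le_trans uL12)// (le_trans len)// expr2 -!mulrA ler_wpM2l//.
by rewrite mulrCA ler_wpM2l// addr_ge0.
Qed.

(** Since [x] itself lies at a definite distance from the boundary, adding that
    distance to the parameter gives a quantity [h] comparable to the distance to
    the boundary all along the carrot.  Cut the carrot where [h] is multiplied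
    by [lam].  Each block is crossed in [N] short steps, hence its image is an
    [H]-link, and from block to block the distance of the image to the boundary
    doubles; so the lengths of the links form a geometric series. *)
Lemma carrot_image (c : R) : 0 <= c -> exists c' : R, 1 <= c' /\
  forall x y, carrot c G x y -> carrot c' G' (F x) (F y).
Proof.
move=> c0; pose K := 1 + 2 * c.
have K1 : 1 <= K by rewrite lerDl mulr_ge0.
have K0 : 0 < K by exact: lt_le_trans K1.
have [r [r0 r1 decay]] := F_decay (ltW K0).
(* By [dh] and [hd] below, [bdist G (s u)] and [h u] agree up to the factor
   [K], so a growth of [h] by [2 * K / r] yields the hypotheses of [decay]. *)
pose lam := 2 * K / r.
have lam2 : 2 <= lam by rewrite /lam ler_pdivlMr//; nra.
have lam0 : 0 < lam by exact: lt_le_trans lam2.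
(* A block has length at most [lam * h u], and steps of length
   [h u / (2 * K)] are at most half the distance to the boundary. *)
pose N := (Num.bound (2 * K * lam)).+1.
have NK : 2 * K * lam <= N%:R.
  rewrite (le_trans (ltW (archi_boundP _)))// ?ler_nat//.
  by apply: mulr_ge0; [apply: mulr_ge0|]; rewrite ?ltW.
have N0 : 0 < N%:R :> R by rewrite ltr0n.
pose H := (1 + B) ^+ N.+1 - 1.
have B0 : 0 <= B by exact: le_trans B1.
have H1 : 1 <= H.
  rewrite lerBrDr exprS.
  have : 1 <= (1 + B) ^+ N by rewrite exprn_ege1// lerDl.
  move=> /(ler_wpM2l (addr_ge0 ler01 B0)); apply: le_trans.
  by rewrite mulr1 lerD2l.
exists (H ^+ 2 * (H + 1)); split.
  by rewrite mulr_ege1// ?exprn_ege1// lerDr (le_trans _ H1).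
move=> x y [L [s [L0 ls s0 sL cs]]].
have in0 : 0 \in `[0, L] by rewrite in_itv/= lexx.
have Gs u : 0 <= u -> u <= L -> G (s u).
  by move=> u0 uL; have [] := cs u; rewrite ?in_itv/= ?u0.
have Gx : G x by rewrite -s0; exact: Gs.
have dx := bdist_gt0 oG GT Gx.
pose h u := bdist G x + u.
have dh u : 0 <= u -> u <= L -> bdist G (s u) <= h u.
  move=> u0 uL; rewrite (le_trans (bdist_lip G _ x))// lerD2l -s0.
  by rewrite (le_trans (ls 0 u _ _ _))// subr0.
have hd u : 0 <= u -> u <= L -> h u <= K * bdist G (s u).
  move=> u0 uL; have [_ cu] : G (s u) /\ u <= c * bdist G (s u).
    by apply: cs; rewrite in_itv/= u0.
  have := bdist_lip G x (s u); have := ls 0 u (lexx _) u0 uL.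
  by rewrite s0 subr0 distrC /h /K => *; lra.
have block u v : 0 <= u -> u <= v -> v <= L -> h v <= lam * h u ->
    linked G' H (F (s u)) (F (s v)).
  move=> u0 uv vL huv.
  pose w (i : nat) := u + i%:R * ((v - u) / N%:R).
  have st0 : 0 <= (v - u) / N%:R by rewrite divr_ge0 ?subr_ge0// ltW.
  have wN : w N = v by rewrite /w mulrC divfK ?gt_eqF// addrC subrK.
  have w0 : w 0 = u by rewrite /w mul0r addr0.
  have w_mono i j : (i <= j)%N -> w i <= w j.
    by move=> ij; rewrite lerD2l ler_wpM2r// ler_nat.
  have wS i : w i.+1 - w i = (v - u) / N%:R by rewrite /w -natr1; ring.
  rewrite -{1}w0 -wN.
  apply: (@linked_chain _ _ G' oG' GT' B N (fun i => F (s (w i)))) => //.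
    by apply: FG; apply: Gs; rewrite w0// (le_trans uv).
  move=> i iN.
  have ui : u <= w i by rewrite -w0 w_mono.
  have iL : w i.+1 <= L by rewrite (le_trans _ vL)// -wN w_mono.
  have ii := w_mono i i.+1 (leqnSn i).
  have Gi : G (s (w i)) by apply: Gs; [exact: le_trans ui|exact: le_trans iL].
  have Gi1 : G (s (w i.+1)) by apply: Gs => //; lra.
  apply: F_links => //; rewrite distrC.
  rewrite (le_trans (ls _ _ _ ii iL)) ?(le_trans u0)// wS.
  have := hd (w i) (le_trans u0 ui) (le_trans ii iL) => hi.
  rewrite ler_pdivrMr//.
  have : v - u <= lam * h u by rewrite (le_trans _ huv)// /h; lra.
  have hui : h u <= h (w i) by rewrite /h lerD2l.
  have hu0 : 0 <= h u by rewrite /h addr_ge0// ltW.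
  have := bdist_gt0 oG GT Gi; set d := bdist G (s (w i)) => d0 vu.
  have : lam * h u <= lam * (K * d).
    by rewrite ler_pM2l// (le_trans hui).
  have : 2 * K * lam * d <= N%:R * d by rewrite ler_pM2r.
  nra.
have doubling u v : 0 <= u -> u <= v -> v <= L -> lam * h u <= h v ->
    2 * bdist G' (F (s u)) <= bdist G' (F (s v)).
  move=> u0 uv vL huv; have uL := le_trans uv vL; have v0 := le_trans u0 uv.
  apply: decay; [exact: Gs|exact: Gs| |].
    have := hd v v0 vL; have := dh u u0 uL; move: huv.
    rewrite /lam mulrAC ler_pdivrMr// => huv du dv.
    have rv : r * h v <= r * (K * bdist G (s v)) by rewrite ler_pM2l.
    rewrite -(ler_pM2l K0); nra.
  rewrite distrC (le_trans (ls u v _ _ _))//.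
  by rewrite (le_trans _ (hd v v0 vL))// /h; lra.
have main n v : 0 <= v -> v <= L -> h v <= lam ^+ n * h 0 ->
    short_carrot H (F x) (F (s v)).
  (* The last cut before [v] is the parameter where [h] equals [h v / lam]. *)
  elim: n v => [|n IH] v v0 vL hv; have [hv0|hv0] := leP (h v) (lam * h 0).
  - by apply: short_carrot_of_link => //; rewrite -s0; exact: block.
  - move: hv hv0; rewrite expr0 mul1r => hv hv0.
    have : 0 < h 0 by rewrite /h addr0.
    nra.
  - by apply: short_carrot_of_link => //; rewrite -s0; exact: block.
  pose u := h v / lam - bdist G x.
  have hu : h u = h v / lam by rewrite /h /u addrC subrK.
  have lam_hu : lam * h u = h v by rewrite hu mulrC divfK// gt_eqF.
  have u0 : 0 <= u by move: hv0; rewrite -lam_hu ltr_pM2l// /h; lra.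
  have uv : u <= v.
    have : 0 <= h u by rewrite /h addr_ge0// ltW.
    move: lam_hu; rewrite /h; nra.
  have uL := le_trans uv vL.
  apply: (@short_carrot_extend H _ (F (s u))) => //.
  - apply: IH => //; rewrite hu ler_pdivrMr//.
    by rewrite mulrAC -exprSr.
  - by apply: block => //; rewrite lam_hu.
  - by apply: doubling => //; rewrite lam_hu.
have h0 : 0 < h 0 by rewrite /h addr0.
have hL0 : 0 <= h L / h 0 by rewrite divr_ge0 ?(ltW h0)// /h addr_ge0// ltW.
have [] := main (Num.bound (h L / h 0)) L L0 (lexx L).
  rewrite -ler_pdivrMr// (le_trans (ltW (archi_boundP hL0)))//.
  apply: (@le_trans _ _ (2 ^+ Num.bound (h L / h 0))).
    by rewrite -natrX ler_nat ltnW// ltn_expl.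
  by rewrite lerXn2r// nnegrE// ltW.
move=> L' [s' [L'0 ls' s'0 s'L [_ cs']]].
by exists L', s'; split => //; rewrite s'L sL.
Qed.

End CarrotTransfer.

(** * Invariance of length John domains *)

Unset Implicit Arguments.

Theorem theorem1p16 (R : realType) (E E' : completeNormedModType R)
    (G : set E) (G' : set E') (M C : R) (eta : R -> R) (f fbar : E -> E') :
  dim_ge2 E -> dim_ge2 E' ->
  is_domain G -> G <> setT -> is_domain G' -> G' <> setT ->
  length_John G ->
  0 < M -> CQH M C G G' f ->
  homeomorphism_on [set t : R | 0 <= t] [set t : R | 0 <= t] eta ->
  (forall x, G x -> fbar x = f x) ->
  homeomorphism_on (closure G) (closure G') fbar ->
  quasisymmetric_rel eta (closure G) (boundary G) fbar ->
  length_John G'.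
Proof.
move=> _ _ [oG _] GT [oG' _] GT' [c [c1 John]] M0.
move=> [[finv [f_in finv_in _ _]] coarse] eta_homeo fbarE fbar_homeo fbar_qs.
have [finvbar [fbar_in finvbar_in _ _]] := fbar_homeo.
have c0 : 0 <= c by exact: le_trans c1.
have fbarG x : G x -> G' (fbar x) by move=> Gx; rewrite fbarE//; case: (f_in x Gx).
have fbar_bd z : boundary G z -> boundary G' (fbar z).
  move=> [cz Gz]; have [cfz fzK] := fbar_in z cz; split => // G'z.
  have [Gy fy] := finv_in _ G'z; apply: Gz.
  have [_ fyK] := fbar_in _ (subset_closure Gy).
  by rewrite -fzK -fy -fbarE// fyK.
have fbar_onto z' : boundary G' z' -> exists2 z, boundary G z & fbar z = z'.
  move=> [cz' Gz']; have [cz fz] := finvbar_in z' cz'.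
  exists (finvbar z') => //; split => // Gz; apply: Gz'.
  by rewrite -fz; exact: fbarG.
(* The constant for links between the images of points at quasihyperbolic
   distance at most one; the absolute value ensures [1 <= B]. *)
pose B := expR (`|M + C| + 1).
have B1 : 1 <= B by rewrite -expR0 ler_expR addr_ge0.
have links p q : G p -> G q -> `|p - q| <= bdist G p / 2 ->
    linked G' B (fbar p) (fbar q).
  move=> Gp Gq pq; apply: linked_of_qh_dist => //.
  have [_ up] := coarse p q Gp Gq; rewrite !fbarE//.
  rewrite (le_trans up)// (@le_trans _ _ (M + C)%:E)// ?lee_fin ?ler_norm//.
  rewrite EFinD leeD2r// -[leRHS]mule1 lee_wpmul2l//; first by rewrite lee_fin ltW.
  exact: qh_dist_le1.
have decay := image_bdist_decay oG GT oG' GT' eta_homeo fbarG fbar_homeo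
  fbar_bd fbar_onto fbar_qs.
have cc0 : 0 <= c * (1 + c) by rewrite mulr_ge0// addr_ge0.
have [c' [c'1 image]] := carrot_image oG GT oG' GT' fbarG B1 links decay cc0.
exists c'; split => // y1 y2 /finv_in[Gx1 fx1] /finv_in[Gx2 fx2].
have d0 x : G x -> 0 <= bdist G x by move=> Gx; rewrite ltW// bdist_gt0.
have [x [x1 x2]] := John_carrots c0 d0 John Gx1 Gx2.
have := carrots_John (image _ _ x1) (image _ _ x2).
by rewrite !fbarE// fx1 fx2.
Qed.
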